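(* Let $A$, $B$, $C$ be $m \times n$ matrices over $\{-1,0,1\}$ such that $A$ has an entry $0$ and $(A,B,C)$ is neither independent from $B$ nor independent from $C$. Suppose $A$ is a layered matrix. Then ${\rm IST}(A,B,C)=\infty$ if and only if $B$ and $C$ are layered matrices.
   Context: For an $m\times n$ matrix $M=[m_{ij}]$ over $\{-1,0,1\}$, $G_o(M)$ is the directed graph on $\{1,\dots,n+m\}$ with edges $j\to i$ for all $1\le j<i\le n$, and for $1\le p\le m$, $1\le j\le n$: an edge $j\to n+p$ if $m_{pj}=1$, an edge $n+p\to j$ if $m_{pj}=-1$, no edge if $m_{pj}=0$; no edges among $n+1,\dots,n+m$. A directed graph is semi-transitive if it is acyclic and for every directed path $u_1\to\cdots\to u_t$, $t\ge2$, either there is no edge $u_1\to u_t$ or all edges $u_i\to u_j$ ($1\le i<j\le t$) exist. For $m\times n$ matrices $A,B,C$ over $\{-1,0,1\}$, the morphism $\varphi$ replaces each entry $0,1,-1$ by the block $A,B,C$ respectively; $M^k(A,B,C)=\varphi^k([0])$ and $G_o^k(A,B,C)=G_o(M^k(A,B,C))$. If $A$ has an entry $0$, ${\rm IST}(A,B,C)$ is the least $\ell\ge0$ with $G_o^\ell(A,B,C)$ not semi-transitive, or $\infty$ if none exists. A matrix is layered if all entries in each row are identical. $(A,B,C)$ is independent from $B$ if there are no $1$'s in $A$ and $C$; it is independent from $C$ if there are no $(-1)$'s in $A$ and $B$.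
   Formalization: The formal theorem also assumes that A is not the zero matrix; without this the claim fails, e.g. A=[0 0], B=[-1 0], C=[1 0], where every M^k is zero, so IST(A,B,C)=∞ although B and C are not layered. *)

(* Defs.v *)
From mathcomp Require Import all_boot all_algebra.
From mathcomp Require Import boolp.
From mathcomp Require Import mxtens.

Set Implicit Arguments.
Unset Strict Implicit.
Unset Printing Implicit Defensive.

(* The alphabet {-1, 0, 1}. *)
Inductive entry : Type := Minus1 | Zero | Plus1.

(* The vertices 1, ..., n + m are numbered from 0: [inl j] is the clique vertex
   j + 1 and [inr p] is the vertex n + (p + 1), attached to row p of [M]. *)
Definition Go_edge m n (M : 'M[entry]_(m, n)) : rel 'I_(n + m) :=
  fun u v =>
    match split u, split v with
    | inl j, inl i => (j < i)%N
    | inl j, inr p => if M p j is Plus1 then true else false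
    | inr p, inl j => if M p j is Minus1 then true else false
    | inr _, inr _ => false
    end.

Definition acyclic (T : eqType) (e : rel T) : Prop :=
  forall c : seq T, cycle e c -> c = [::].

(* Vertices may a priori repeat along a [path] or a [cycle]; once [e] is acyclic
   no vertex does, so these are directed paths in the usual sense.  Here t >= 2,
   u_1, u_2 are the first two vertices, and u_t = last u2 p. *)
Definition semi_transitive (T : eqType) (e : rel T) : Prop :=
  acyclic e /\
  forall (u1 u2 : T) (p : seq T), path e u1 (u2 :: p) ->
    ~~ e u1 (last u2 p) \/ pairwise e [:: u1, u2 & p].

Section Morphism.
Variables (m n : nat) (A B C : 'M[entry]_(m, n)).

Definition phi_entry (x : entry) : 'M[entry]_(m, n) :=
  match x with Zero => A | Plus1 => B | Minus1 => C end.

(* [mxtens_unindex i] is the pair (i %/ m, i %% m): block row, then row inside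
   the block; likewise for columns. *)
Definition phi p q (X : 'M[entry]_(p, q)) : 'M[entry]_(p * m, q * n) :=
  \matrix_(i, j)
    phi_entry (X (mxtens_unindex i).1 (mxtens_unindex j).1)
              (mxtens_unindex i).2 (mxtens_unindex j).2.

(* Equal to d ^ k; this form makes dim d k.+1 convertible to dim d k * d, so
   that the iteration of [phi] needs no cast. *)
Definition dim (d k : nat) : nat := iter k (muln^~ d) 1%N.

Fixpoint Mk (k : nat) : 'M[entry]_(dim m k, dim n k) :=
  match k with
  | 0 => const_mx Zero
  | k'.+1 => phi (Mk k')
  end.
Arguments Mk k : clear implicits.

Definition Gok (k : nat) : rel 'I_(dim n k + dim m k) := Go_edge (Mk k).
Arguments Gok k : clear implicits.

(* [None] stands for infinity. *)
Definition IST : option nat :=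
  if pselect (exists l, `[< ~ semi_transitive (Gok l) >]) is left ex
  then Some (ex_minn ex) else None.

Definition independent_from_B : Prop :=
  (forall i j, A i j <> Plus1) /\ (forall i j, C i j <> Plus1).

Definition independent_from_C : Prop :=
  (forall i j, A i j <> Minus1) /\ (forall i j, B i j <> Minus1).

End Morphism.

Arguments Mk {m n} A B C k.
Arguments Gok {m n} A B C k.

Definition layered m n (M : 'M[entry]_(m, n)) : Prop :=
  forall i j j', M i j = M i j'.

(* Main.v *)
Require Import Defs.
From mathcomp Require Import all_boot all_algebra.
From mathcomp Require Import boolp mxtens.

Set Implicit Arguments.
Unset Strict Implicit.
Unset Printing Implicit Defensive.

(** If [A], [B], [C] are layered then every [M^k] is layered, and a layered
    matrix gives an orientation that becomes transitive once all edges from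
    sources to sinks among the independent vertices are added.  Conversely, if
    [M^k] has a constant row with entry [x] and at least two columns, then each
    row [r] of the block [phi_entry x] is repeated as [r r ... r] in [M^(k+1)];
    semi-transitivity forbids the patterns [1 0 1], [-1 0 -1] and [-1 1] in a
    row, so [r] must be constant.  The hypotheses on [A] and the two
    non-independence conditions produce constant rows of 1's and of -1's in
    [M^1] or [M^2]. *)

Section Edges.
Variables (m n : nat) (M : 'M[entry]_(m, n)).

Lemma Go_edge_ll (i j : 'I_n) :
  Go_edge M (lshift m i) (lshift m j) = (i < j).
Proof. by rewrite /Go_edge !(unsplitK (inl _)). Qed.

Lemma Go_edge_lr (j : 'I_n) (p : 'I_m) :
  Go_edge M (lshift m j) (rshift n p) = if M p j is Plus1 then true else false.
Proof. by rewrite /Go_edge (unsplitK (inl _)) (unsplitK (inr _)). Qed.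

Lemma Go_edge_rl (j : 'I_n) (p : 'I_m) :
  Go_edge M (rshift n p) (lshift m j) = if M p j is Minus1 then true else false.
Proof. by rewrite /Go_edge (unsplitK (inl _)) (unsplitK (inr _)). Qed.

(** Three columns would not do, since [0 1 0] is harmless; an alternation [x y x y] with [x] and [y]
    distinct always contains one of the three forbidden patterns. *)
Lemma semi_transitive_no_alternation (p : 'I_m) (j1 j2 j3 j4 : 'I_n) :
    semi_transitive (Go_edge M) -> j1 < j2 -> j2 < j3 -> j3 < j4 ->
    M p j3 = M p j1 -> M p j4 = M p j2 ->
  M p j1 = M p j2.
Proof.
move=> [acyc trans] lt12 lt23 lt34 e31 e42.
have no_minus_plus (i j : 'I_n) : i < j -> M p i = Minus1 -> M p j <> Plus1.
  move=> ltij Mi Mj.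
  suff /acyc : cycle (Go_edge M) [:: rshift n p; lshift m i; lshift m j] by [].
  by rewrite /= Go_edge_rl Mi Go_edge_ll ltij Go_edge_lr Mj.
have no_gap_plus (i j k : 'I_n) : i < j -> j < k -> M p i = Plus1 -> M p j = Zero ->
    M p k <> Plus1.
  move=> ltij ltjk Mi Mj Mk.
  (* The edge from [i] to the row vertex is a shortcut of this path, but the edge from [j] is
     missing. *)
  have [|/negP|] := trans (lshift m i) (lshift m j) [:: lshift m k; rshift n p].
  - by rewrite /= !Go_edge_ll ltij ltjk Go_edge_lr Mk.
  - by rewrite /= Go_edge_lr Mi.
  - by rewrite /= !Go_edge_lr Mj !andbF.
have no_gap_minus (i j k : 'I_n) : i < j -> j < k -> M p i = Minus1 -> M p j = Zero ->
    M p k <> Minus1.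
  move=> ltij ltjk Mi Mj Mk.
  have [|/negP|] := trans (rshift n p) (lshift m i) [:: lshift m j; lshift m k].
  - by rewrite /= !Go_edge_ll ltij ltjk Go_edge_rl Mi.
  - by rewrite /= Go_edge_rl Mk.
  - by rewrite /= !Go_edge_rl Mj andbF.
case M1: (M p j1) e31 => e31; case M2: (M p j2) e42 => e42 //.
- by case: (no_gap_minus _ _ _ lt12 lt23 M1 M2).
- by case: (no_minus_plus _ _ lt12 M1).
- by case: (no_gap_minus _ _ _ lt23 lt34 M2 e31).
- by case: (no_gap_plus _ _ _ lt23 lt34 M2 e31).
- by case: (no_minus_plus _ _ lt23 M2).
- by case: (no_gap_plus _ _ _ lt12 lt23 M1 M2).
Qed.

Definition is_plus (x : entry) : bool := if x is Plus1 then true else false.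
Definition is_minus (x : entry) : bool := if x is Minus1 then true else false.

(** Only independent vertices count: the least clique vertex is left out even when nothing enters
    it. *)
Definition Go_source (u : 'I_(n + m)) : bool :=
  if split u is inr p then [exists j, is_minus (M p j)] else false.
Definition Go_sink (u : 'I_(n + m)) : bool :=
  if split u is inr p then [exists j, is_plus (M p j)] else false.

Definition Go_closure : rel 'I_(n + m) :=
  fun u v => Go_edge M u v || (Go_source u && Go_sink v).

Hypothesis M_layered : layered M.

(** In a layered matrix a row with a -1 has no 1, so its vertex is entered neither from the clique
    nor, not being a sink, by an added edge. *)
Lemma Go_source_no_in (u v : 'I_(n + m)) : Go_closure u v -> ~~ Go_source v.
Proof.
rewrite /Go_closure /Go_edge /Go_source /Go_sink.
case: (split u) (split v) => [j|p] [i|q] //=.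
  rewrite orbF => Mqj; apply/existsPn => i; rewrite (M_layered _ _ j).
  by case: (M q j) Mqj.
case/andP=> _ /existsP[j Mqj]; apply/existsPn => i; rewrite (M_layered _ _ j).
by case: (M q j) Mqj.
Qed.

Lemma Go_sink_no_out (u v : 'I_(n + m)) : Go_closure u v -> ~~ Go_sink u.
Proof.
rewrite /Go_closure /Go_edge /Go_source /Go_sink.
case: (split u) (split v) => [j|p] [i|q] //=.
  rewrite andbF orbF => Mpi; apply/existsPn => j; rewrite (M_layered _ _ i).
  by case: (M p i) Mpi.
case/andP=> /existsP[j Mpj] _; apply/existsPn => i; rewrite (M_layered _ _ j).
by case: (M p j) Mpj.
Qed.

(** The middle vertex [v] must lie in the clique: an independent vertex with an outgoing edge is a
    source, and nothing enters a source. *)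
Lemma Go_closure_trans : transitive Go_closure.
Proof.
move=> v u w uv vw; have Nv := Go_source_no_in uv; have Nv' := Go_sink_no_out vw.
move: Nv Nv' uv vw.
rewrite /Go_closure /Go_edge /Go_source /Go_sink.
case: (split u) (split v) (split w) => [j|p] [i|q] [k|r] //=;
  rewrite ?(andbF, orbF) => Nsrc Nsnk.
- exact: ltn_trans.
- by move=> _; rewrite (M_layered _ _ j).
- by move=> _ Mqk; case/negP: Nsrc; apply/existsP; exists k.
- by move=> _ /andP[Nsrc']; rewrite Nsrc' in Nsrc.
- by rewrite (M_layered _ _ k).
(* From a source through the clique to a sink: the one case that needs an added edge. *)
- by move=> Mpi Mri; apply/andP; split; apply/existsP; exists i.
- by move=> /andP[_ Nsnk']; rewrite Nsnk' in Nsnk.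
- by move=> _ /andP[Nsrc']; rewrite Nsrc' in Nsrc.
Qed.

Lemma Go_closure_irr : irreflexive Go_closure.
Proof.
move=> u; apply/negP => uu; have := Go_source_no_in uu; move: uu.
rewrite /Go_closure => uu /negPf Nu; move: uu; rewrite Nu orbF /Go_edge.
by case: (split u) => // i; rewrite ltnn.
Qed.

(** A path closed by a genuine edge cannot both start at a source and end at a sink. Hence it avoids
    all sources or all sinks, and on its vertices [Go_closure] adds nothing to [Go_edge]. *)
Lemma layered_semi_transitive : semi_transitive (Go_edge M).
Proof.
have sub : subrel (Go_edge M) Go_closure by move=> u v uv; rewrite /Go_closure uv.
split=> [[//|x c] /= /(sub_path sub)|u1 u2 p /(sub_path sub)].
  rewrite (path_sortedE Go_closure_trans) all_rcons => /andP[/andP[xx _] _].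
  by rewrite Go_closure_irr in xx.
set s := u2 :: p => path_s; set t := last u2 p.
have [e1t|] := boolP (Go_edge M u1 t); [right|by left].
have closed : pairwise Go_closure (u1 :: s).
  by rewrite -(sorted_pairwise Go_closure_trans).
have upgrade P : {in P &, subrel Go_closure (Go_edge M)} -> all P (u1 :: s) ->
    pairwise (Go_edge M) (u1 :: s).
  by move=> subP Ps; apply: sub_in_pairwise Ps closed.
have [src|nsrc] := boolP (Go_source u1); last first.
  apply: (upgrade [pred u | ~~ Go_source u]).
    by move=> u v /= /negPf Nu _; rewrite /Go_closure Nu orbF.
  move: closed; rewrite pairwise_cons => /andP[/allP closed1 _].
  apply/allP => u; rewrite in_cons => /predU1P[-> //|us].
  exact: Go_source_no_in (closed1 _ us).
(* Sources and sinks are independent vertices, so no edge of the graph joins them. *)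
have nsnk : ~~ Go_sink t.
  move: src e1t; rewrite /Go_edge /Go_source /Go_sink.
  by case: (split u1) (split t) => [?|?] [?|?].
apply: (upgrade [pred u | ~~ Go_sink u]).
  by move=> u v /= _ /negPf Nv; rewrite /Go_closure Nv andbF orbF.
move: closed; rewrite /s lastI [last _ _]/= -/t pairwise_rcons.
case/andP=> /allP closed_t _; apply/allP => u; rewrite mem_rcons in_cons.
by case/predU1P=> [-> //|us]; apply: Go_sink_no_out (closed_t _ us).
Qed.

End Edges.

Definition constant_row m n (M : 'M[entry]_(m, n)) (x : entry) : Prop :=
  exists i, forall j, M i j = x.

Lemma layered_constant_row m n (M : 'M[entry]_(m, n)) (x : entry) :
  layered M -> (exists i j, M i j = x) -> constant_row M x.
Proof. by move=> lM [i [j Mij]]; exists i => j'; rewrite -Mij; apply: lM. Qed.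

Section Iteration.
Variables (m n : nat) (A B C : 'M[entry]_(m, n)).

Lemma phi_mxtens p q (X : 'M[entry]_(p, q)) i i' j j' :
  phi A B C X (mxtens_index (i, i')) (mxtens_index (j, j')) =
  phi_entry A B C (X i j) i' j'.
Proof. by rewrite mxE !mxtens_indexK. Qed.

Lemma phi_constant_row p q (X : 'M[entry]_(p, q)) (x y : entry) :
  constant_row X x -> constant_row (phi_entry A B C x) y ->
  constant_row (phi A B C X) y.
Proof.
move=> [i Xi] [i' xi']; exists (mxtens_index (i, i')) => j.
by rewrite -[j]mxtens_unindexK; case: mxtens_unindex => j1 j2;
   rewrite phi_mxtens Xi.
Qed.

Lemma phi_layered p q (X : 'M[entry]_(p, q)) :
  layered A -> layered B -> layered C -> layered X -> layered (phi A B C X).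
Proof.
move=> lA lB lC lX i j j'; rewrite !mxE (lX _ _ (mxtens_unindex j').1).
by case: (X _ _) => /=; [apply: lC|apply: lA|apply: lB].
Qed.

(** Columns [j < j'] of block columns 0 and 1 give four columns whose entries alternate. *)
Lemma constant_row_semi_transitive p q (X : 'M[entry]_(p, q)) (x : entry) :
  1 < q -> constant_row X x -> semi_transitive (Go_edge (phi A B C X)) ->
  layered (phi_entry A B C x).
Proof.
move=> q_gt1 [i Xi] stX i'.
suff lt_eq (j j' : 'I_n) : j < j' ->
    phi_entry A B C x i' j = phi_entry A B C x i' j'.
  move=> j j'; case: (ltngtP j j') => [/lt_eq //|/lt_eq //|/val_inj -> //].
move=> ltjj'; pose b0 := Ordinal (ltnW q_gt1); pose b1 := Ordinal q_gt1.
have val b k : phi A B C X (mxtens_index (i, i')) (mxtens_index (b, k)) =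
    phi_entry A B C x i' k by rewrite phi_mxtens Xi.
rewrite -!(val b0).
apply: (@semi_transitive_no_alternation _ _ _ _ _ _
         (mxtens_index (b1, j)) (mxtens_index (b1, j')) stX);
  rewrite ?val //= ?mul0n ?mul1n ?add0n ?ltn_add2l //.
(* Column [j'] of block 0 precedes column [j] of block 1: [j' < n + j]. *)
exact: leq_trans (ltn_ord j') (leq_addr _ _).
Qed.

Lemma dimE d k : Defs.dim d k = d ^ k.
Proof. by elim: k => //= k ->; rewrite expnSr. Qed.

(** The exponent is [k.+1] because [Mk 0] has a single column, while for [n > 1] all later iterates
    have at least two. For [n <= 1] every block is trivially layered. *)
Lemma Mk_constant_row_layered k (x : entry) :
  (forall l, semi_transitive (Gok A B C l)) ->
  constant_row (Mk A B C k.+1) x -> layered (phi_entry A B C x).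
Proof.
move=> st rowx; case: (ltnP 1 n) => [n_gt1|n_le1].
  apply: (constant_row_semi_transitive _ rowx (st k.+2)).
  by rewrite dimE -(exp1n k.+1) ltn_exp2r.
move=> i j j'; congr (phi_entry A B C x i _); apply/val_inj.
have lt0 (l : 'I_n) : val l = 0.
  by case: l => [[|l]] //= ln; have := leq_trans ln n_le1.
by rewrite !lt0.
Qed.

Lemma IST_NoneP :
  IST A B C = None <-> forall l, semi_transitive (Gok A B C l).
Proof.
rewrite /IST; case: pselect => [ex|nex]; split=> //.
  by move=> st; have [l /asboolP nst] := ex; case: (nst (st l)).
move=> _ l; apply: contrapT => nst; apply: nex; exists l; exact/asboolP.
Qed.

Lemma Mk_layered k :
  layered A -> layered B -> layered C -> layered (Mk A B C k).
Proof.
by move=> lA lB lC; elim: k => [i j j'|k]; [rewrite !mxE|apply: phi_layered].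
Qed.

End Iteration.

(* If A = 0 then every M^k is the zero matrix, whatever B and C are: IST is then
   infinite and the equivalence fails.  [A_neq0] excludes exactly that case. *)
Theorem theorem3p14 (m n : nat) (A B C : 'M[entry]_(m, n))
  (A_has_0 : exists i j, A i j = Zero)
  (A_neq0 : exists i j, A i j <> Zero)
  (not_indep_B : ~ independent_from_B A C)
  (not_indep_C : ~ independent_from_C A B)
  (A_layered : layered A) :
  IST A B C = None <-> layered B /\ layered C.
Proof.
rewrite IST_NoneP; split=> [st|[lB lC] l]; last first.
  exact/layered_semi_transitive/Mk_layered.
(* [Mk 1] is the image of the single entry 0, that is, a copy of [A]. *)
have rowA x : (exists i j, A i j = x) -> constant_row (Mk A B C 1) x.
  move=> Ax; apply: (@phi_constant_row _ _ _ _ _ _ _ _ Zero).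
    by exists ord0 => j; rewrite mxE.
  exact: layered_constant_row.
have step x y : constant_row (Mk A B C 1) x -> layered (phi_entry A B C x) ->
    (exists i j, phi_entry A B C x i j = y) -> constant_row (Mk A B C 2) y.
  move=> rowx lx xy.
  exact: phi_constant_row rowx (layered_constant_row lx xy).
have has (X Y : 'M[entry]_(m, n)) x :
    ~ ((forall i j, X i j <> x) /\ (forall i j, Y i j <> x)) ->
    (exists i j, X i j = x) \/ (exists i j, Y i j = x).
  move=> H; apply: contrapT => /not_orP[nX nY]; apply: H.
  by split=> i j e; [apply: nX|apply: nY]; exists i, j.
have plus_or_minus : (exists i j, A i j = Plus1) \/ (exists i j, A i j = Minus1).
  case: A_neq0 => i [j]; case Aij: (A i j) => // _; [right|left]; by exists i, j.
have layeredP := Mk_constant_row_layered st.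
(* A row of 1's in [A] makes [B] layered; the -1 needed for [C] then lies in [A], giving a row of
   [Mk 1], or in [B], giving a row of [Mk 2]. The other case is symmetric. *)
case: plus_or_minus => /rowA row1; have l1 := layeredP _ _ row1; split=> //.
- case: (has _ _ _ not_indep_C) => [/rowA /layeredP //|Bm].
  exact: layeredP (step _ _ row1 l1 Bm).
- case: (has _ _ _ not_indep_B) => [/rowA /layeredP //|Cp].
  exact: layeredP (step _ _ row1 l1 Cp).
Qed.
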